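(* Let $C$ be a bivariate copula and let $\tau=\tau(C)\in[-1,1]$ be its Kendall's tau. Then Blomqvist's beta $\beta(C)$ satisfies $\ell(\tau)\leqslant\beta(C)\leqslant h(\tau)$, where $$\ell(\tau)=\begin{cases}-1, & \text{if } \tau\leqslant 0,\\ 1-2\sqrt{1-\tau}, & \text{otherwise,}\end{cases}\qquad h(\tau)=\begin{cases}1, & \text{if } \tau\geqslant 0,\\ -1+2\sqrt{1+\tau}, & \text{otherwise.}\end{cases}$$
   Context: A bivariate copula is a function $C:[0,1]^2\to[0,1]$ with $C(u,0)=C(0,v)=0$, $C(u,1)=u$, $C(1,v)=v$, that is 2-increasing. Blomqvist's beta: $\beta(C)=4C\left(\tfrac12,\tfrac12\right)-1$. Concordance function: for copulas $C_1,C_2$, $\mathcal{Q}(C_1,C_2)=4\int_{[0,1]^2}C_2(u,v)\,dC_1(u,v)-1$, where $dC_1$ denotes integration with respect to the probability measure on $[0,1]^2$ with distribution function $C_1$. Kendall's tau: $\tau(C)=\mathcal{Q}(C,C)$. *)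

(* Defs.v *)
From mathcomp Require Import all_boot all_order all_algebra.
From mathcomp Require Import all_classical all_reals all_analysis.

Set Implicit Arguments.
Unset Strict Implicit.
Unset Printing Implicit Defensive.

Import Order.TTheory GRing.Theory Num.Theory.
Import numFieldNormedType.Exports.

Local Open Scope classical_set_scope.
Local Open Scope ring_scope.

(* A function on [0,1]^2 is represented by a function on R^2; its values off
   the unit square are arbitrary and never used below. *)
Record copula (R : realType) (C : R -> R -> R) : Prop := Copula {
  copula_range : forall u v, u \in `[0, 1] -> v \in `[0, 1] ->
    C u v \in `[0, 1];
  copulax0 : forall u, u \in `[0, 1] -> C u 0 = 0;
  copula0x : forall v, v \in `[0, 1] -> C 0 v = 0;
  copulax1 : forall u, u \in `[0, 1] -> C u 1 = u;
  copula1x : forall v, v \in `[0, 1] -> C 1 v = v;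
  copula_2incr : forall u1 u2 v1 v2,
    0 <= u1 -> u1 <= u2 -> u2 <= 1 -> 0 <= v1 -> v1 <= v2 -> v2 <= 1 ->
    0 <= C u2 v2 - C u2 v1 - C u1 v2 + C u1 v1 }.

Definition unit_square (R : realType) : set (R * R) := `[0, 1] `*` `[0, 1].

(* Since C 1 1 = 1 for a copula, a probability measure on R^2 satisfying this
   is concentrated on the unit square. *)
Definition has_cdf (R : realType)
    (P : probability (measurableTypeR R * measurableTypeR R)%type R)
    (C : R -> R -> R) : Prop :=
  forall u v : R, u \in `[0, 1] -> v \in `[0, 1] ->
    P (`[0, u] `*` `[0, v]) = (C u v)%:E.

(* The probability measure with distribution function C: for a copula it exists
   and is unique (Lebesgue-Stieltjes). The Dirac mass at the origin is only a
   default value making the definition total. *)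
Definition copula_measure (R : realType) (C : R -> R -> R) :
    probability (measurableTypeR R * measurableTypeR R)%type R :=
  match pselect (exists P, has_cdf P C) with
  | left PC => projT1 (cid PC)
  | right _ => dirac ((0, 0) : measurableTypeR R * measurableTypeR R)
  end.

Definition concordance (R : realType) (C1 C2 : R -> R -> R) : R :=
  4 * (\int[copula_measure C1]_(z in @unit_square R) C2 z.1 z.2) - 1.

Definition kendall_tau (R : realType) (C : R -> R -> R) : R := concordance C C.

Definition blomqvist_beta (R : realType) (C : R -> R -> R) : R :=
  4 * C (1 / 2) (1 / 2) - 1.

Definition beta_lower (R : realType) (tau : R) : R :=
  if tau <= 0 then -1 else 1 - 2 * Num.sqrt (1 - tau).

Definition beta_upper (R : realType) (tau : R) : R :=
  if 0 <= tau then 1 else -1 + 2 * Num.sqrt (1 + tau).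

(* Main.v *)
Require Import Defs.
From mathcomp Require Import all_boot all_order all_algebra.
From mathcomp Require Import all_classical all_reals all_analysis.
From mathcomp Require Import measurable_realfun ring lra.

(* Let P be the measure with distribution function C and d = C(1/2, 1/2). The
   quadrants of the square around its center have P-mass d on the diagonal and
   1/2 - d off it. On the upper right quadrant C >= d, so the integral of C dP
   is at least d^2. On the two off-diagonal quadrants the nonnegative function
   u + v - 2 C(u, v) is at least 1/2 - d, and u + v has integral 1 since the
   margins are uniform, so the integral of C dP is at most
   1/2 - (1/2 - d)^2. Both bounds on beta are these inequalities solved for d.

   P exists as an image of Lebesgue measure on [0, 1[: subdivide the unit
   square dyadically, assign to each dyadic square an interval whose length is
   its C-volume, nested as the squares are, and send a point to the limit of
   the corners of the squares whose intervals contain it. *)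

Set Implicit Arguments.
Unset Strict Implicit.
Unset Printing Implicit Defensive.

Import Order.TTheory GRing.Theory Num.Theory.
Import numFieldNormedType.Exports.

Local Open Scope classical_set_scope.
Local Open Scope ring_scope.

(** * Existence of the measure of a copula *)

Section halving.
Context (R : realType).

Lemma exprhalf_lt (e : R) : 0 < e -> exists n, 2 ^- n < e.
Proof.
move=> e0; exists (Num.bound e^-1).
rewrite -[ltRHS]invrK ltf_pV2 ?posrE ?invr_gt0 ?exprn_gt0 //.
apply: (lt_le_trans (archi_boundP _)); first by rewrite invr_ge0 ltW.
by rewrite -natrX ler_nat ltnW // ltn_expl.
Qed.

(** As [2 ^- n = 2 ^- n.+1 + 2 ^- n.+1], the sequence [w n + 2 ^- n] decreases while [w] increases,
    so each of its terms bounds [w] and hence the limit. *)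
Lemma limn_halving (w : nat -> R) :
  (forall n, w n <= w n.+1 <= w n + 2 ^- n.+1) ->
  cvgn w /\ forall n, w n <= limn w <= w n + 2 ^- n.
Proof.
move=> hw.
have nd : {homo w : n m / (n <= m)%N >-> n <= m}.
  by apply/nondecreasing_seqP => n; case/andP: (hw n).
have ni : {homo (fun n => w n + 2 ^- n) : n m / (n <= m)%N >-> m <= n}.
  apply/nonincreasing_seqP => n; case/andP: (hw n) => _ h.
  have -> : 2 ^- n = 2 * 2 ^- n.+1 :> R by rewrite exprS; field; rewrite expf_neq0.
  lra.
have wb n m : w m <= w n + 2 ^- n.
  have h1 := nd _ _ (leq_maxl m n); have h2 := ni _ _ (leq_maxr m n).
  have h3 : 0 <= 2 ^- maxn m n :> R by rewrite invr_ge0 exprn_ge0.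
  by apply: le_trans h2; lra.
have cw : cvgn w.
  by apply: nondecreasing_is_cvgn => //; exists (w 0 + 2 ^- 0) => _ [m _ <-]; exact: wb.
split => // n; rewrite nondecreasing_cvgn_le //=.
by apply: limr_le => //; exact: nearW.
Qed.

End halving.

(** * Volumes of squares and their layout on an interval *)

Section copula_existence.
Context (R : realType) (C : R -> R -> R).
Hypothesis hC : copula C.
Local Notation mu := (@lebesgue_measure R).

(** The [D]-volume of the square of side [h] with lower left corner [(x, y)]. *)
Definition sqvol (D : R -> R -> R) (x y h : R) : R :=
  D (x + h) (y + h) - D (x + h) y - D x (y + h) + D x y.

Lemma sqvol_split D x y h :
  sqvol D x y (h / 2) + sqvol D (x + h / 2) y (h / 2) +
  sqvol D x (y + h / 2) (h / 2) + sqvol D (x + h / 2) (y + h / 2) (h / 2) =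
  sqvol D x y h.
Proof.
have hh z : z + h / 2 + h / 2 = z + h by lra.
by rewrite /sqvol !hh; ring.
Qed.

(** Its volume over a square is the [C]-volume of the part of the square below [(u, v)]. *)
Definition trunc_cdf (u v s t : R) : R := C (Num.min s u) (Num.min t v).

Lemma sqvol_trunc_ge0 u v x y h : 0 <= u -> 0 <= v -> 0 <= h ->
  0 <= x -> x + h <= 1 -> 0 <= y -> y + h <= 1 -> 0 <= sqvol (trunc_cdf u v) x y h.
Proof.
move=> u0 v0 h0 x0 x1 y0 y1; apply: (copula_2incr hC).
- by rewrite le_min x0.
- by rewrite le_min2 // lerDl.
- by rewrite ge_min x1.
- by rewrite le_min y0.
- by rewrite le_min2 // lerDl.
- by rewrite ge_min y1.
Qed.

Lemma sqvol_ge0 x y h : 0 <= h ->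
  0 <= x -> x + h <= 1 -> 0 <= y -> y + h <= 1 -> 0 <= sqvol C x y h.
Proof.
by move=> h0 x0 x1 y0 y1; apply: (copula_2incr hC) => //; rewrite lerDl.
Qed.

(** If the corner is not below [(u, v)], the truncated volume cancels to 0. Otherwise truncation
    cuts the square down to [[x, x'] x [y, y']]; the rest is made of two rectangles, whose volumes
    are nonnegative by [H1] and [H2]. *)
Lemma sqvol_trunc_le u v x y h : 0 <= u -> 0 <= v -> 0 <= h ->
  0 <= x -> x + h <= 1 -> 0 <= y -> y + h <= 1 ->
  sqvol (trunc_cdf u v) x y h <= (if (x < u) && (y < v) then sqvol C x y h else 0).
Proof.
move=> u0 v0 h0 x0 x1 y0 y1.
have [xu|ux] /= := ltP x u; last first.
  rewrite /sqvol /trunc_cdf (min_idPr ux) (min_idPr _) ?(le_trans ux) ?lerDl //.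
  by rewrite le_eqVlt; apply/orP; left; apply/eqP; ring.
have [yv|vy] /= := ltP y v; last first.
  rewrite /sqvol /trunc_cdf (min_idPr vy) (@min_idPr _ _ (y + h) _ _) ?(le_trans vy) ?lerDl //.
  by rewrite le_eqVlt; apply/orP; left; apply/eqP; ring.
rewrite /sqvol /trunc_cdf (min_idPl (ltW xu)) (min_idPl (ltW yv)).
set x' := Num.min (x + h) u; set y' := Num.min (y + h) v.
have xx' : x <= x' by rewrite le_min lerDl h0 ltW.
have yy' : y <= y' by rewrite le_min lerDl h0 ltW.
have x'x : x' <= x + h by rewrite ge_min lexx.
have y'y : y' <= y + h by rewrite ge_min lexx.
have H1 : 0 <= C (x + h) y' - C (x + h) y - C x' y' + C x' y.
  by apply: (copula_2incr hC) => //; lra.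
have H2 : 0 <= C (x + h) (y + h) - C (x + h) y' - C x (y + h) + C x y'.
  by apply: (copula_2incr hC) => //; lra.
lra.
Qed.

(** A square of side [h] whose corner is below [(u, v)] lies entirely below [(u + h, v + h)], so
    truncation there does not affect it. *)
Lemma le_sqvol_trunc u v x y h : 0 <= u -> 0 <= v -> 0 <= h ->
  0 <= x -> x + h <= 1 -> 0 <= y -> y + h <= 1 ->
  (if (x < u) && (y < v) then sqvol C x y h else 0) <= sqvol (trunc_cdf (u + h) (v + h)) x y h.
Proof.
move=> u0 v0 h0 x0 x1 y0 y1.
case: ifPn => [/andP[xu yv]|_]; last by apply: sqvol_trunc_ge0; rewrite ?addr_ge0.
by rewrite /sqvol /trunc_cdf !(min_idPl _) ?lerD2r //; lra.
Qed.

(* [corner n x y h a t] is the lower left corner of the dyadic subsquare of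
   side [h / 2^n] whose interval contains [t], when the intervals of the
   subsquares, of lengths their [C]-volumes, are laid out consecutively from [a]. *)
Fixpoint corner n (x y h a t : R) : R * R :=
  if n is m.+1 then
    let k := h / 2 in
    let a1 := a + sqvol C x y k in
    let a2 := a1 + sqvol C (x + k) y k in
    let a3 := a2 + sqvol C x (y + k) k in
    if t < a1 then corner m x y k a t
    else if t < a2 then corner m (x + k) y k a1 t
    else if t < a3 then corner m x (y + k) k a2 t
    else corner m (x + k) (y + k) k a3 t
  else (x, y).

(** Unfolds one level only, keeping the inner occurrences of [corner] folded. *)
Lemma cornerS n x y h a t : corner n.+1 x y h a t =
    let k := h / 2 in
    let a1 := a + sqvol C x y k in
    let a2 := a1 + sqvol C (x + k) y k in
    let a3 := a2 + sqvol C x (y + k) k in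
    if t < a1 then corner n x y k a t
    else if t < a2 then corner n (x + k) y k a1 t
    else if t < a3 then corner n x (y + k) k a2 t
    else corner n (x + k) (y + k) k a3 t.
Proof. by []. Qed.

Lemma measurable_corner n x y h a :
  measurable_fun setT
    (corner n x y h a : measurableTypeR R -> measurableTypeR R * measurableTypeR R).
Proof.
elim: n x y h a => [|n IH] x y h a /=; first exact: measurable_cst.
have mlt (c : R) : measurable_fun setT (fun t : measurableTypeR R => t < c).
  by apply: measurable_fun_ltr.
by do 3![apply: measurable_fun_ifT => //].
Qed.

Lemma corner_ge n x y h a t : 0 <= h ->
  x <= (corner n x y h a t).1 /\ y <= (corner n x y h a t).2.
Proof.
elim: n x y h a => [|n IH] x y h a h0 //=.
have k0 : 0 <= h / 2 by rewrite divr_ge0.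
by do 3?[case: ifP => _]; split;
  match goal with |- context [corner n ?a ?b ?c ?d t] =>
    have [] := IH a b c d k0 end; lra.
Qed.

(** Depths [n] and [n.+1] make the same first choice, because the thresholds do not depend on the
    depth; the claim thus passes to a square of half the side. *)
Lemma corner_step n x y h a t : 0 <= h ->
  let c := corner n x y h a t in let c' := corner n.+1 x y h a t in
  let e := h / 2 ^+ n.+1 in
  [/\ c.1 <= c'.1, c'.1 <= c.1 + e, c.2 <= c'.2 & c'.2 <= c.2 + e].
Proof.
elim: n x y h a => [|n IH] x y h a h0.
  by rewrite /= expr1; do 3?[case: ifP => _]; split => /=; lra.
have k0 : 0 <= h / 2 by rewrite divr_ge0.
have -> : h / 2 ^+ n.+2 = h / 2 / 2 ^+ n.+1 by rewrite exprS invfM mulrA.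
rewrite (cornerS n.+1) (cornerS n); cbv zeta.
by do 3?[case: ifP => _]; apply: IH.
Qed.

Lemma lebesgue_measure_itv_split (A : set (measurableTypeR R)) (a b c : R) :
  measurable A -> a <= b -> b <= c ->
  mu (`[a, c[ `&` A) = (mu (`[a, b[ `&` A) + mu (`[b, c[ `&` A))%E.
Proof.
move=> mA ab bc; rewrite -measureU.
- rewrite -setIUl; congr (mu (_ `&` _)); apply/seteqP; split => t /=; rewrite !in_itv /=.
    by case: (ltP t b) => tb /andP[at_ tc]; [left|right]; apply/andP.
  by case=> /andP[at_ tc]; apply/andP; split; lra.
- exact: measurableI.
- exact: measurableI.
- apply/seteqP; split => // t [[/= + _] [+ _]]; rewrite !in_itv /= => /andP[_ tb] /andP[bt _].
  by move: tb; rewrite ltNge bt.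
Qed.

Definition below u v (f : R -> R * R) : set (measurableTypeR R) :=
  [set t | (f t).1 < u /\ (f t).2 < v].

Lemma measurable_below u v n x y h a : measurable (below u v (corner n x y h a)).
Proof.
have := @measurable_corner n x y h a measurableT (`]-oo, u[ `*` `]-oo, v[).
have mI : measurable
    (`]-oo, u[ `*` `]-oo, v[ : set (measurableTypeR R * measurableTypeR R)) by exact: measurableX.
rewrite setTI => /(_ mI).
by congr measurable; apply/seteqP; split => t /=; rewrite !in_itv.
Qed.

Lemma eq_below u v (a b : R) (f g : R -> R * R) :
  (forall t, a <= t -> t < b -> f t = g t) ->
  `[a, b[ `&` below u v f = `[a, b[ `&` below u v g.
Proof.
move=> fg; apply/seteqP; split => t [tab]; move: (tab); rewrite /= in_itv /= => /andP[at_ tb].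
  by rewrite /below /= fg.
by rewrite /below /= fg.
Qed.

(** Here [e] is the side of the smallest squares, fixed during the induction. At depth 0 [corner] is
    constant, so the set is the whole interval or empty. At the next depth the interval splits into
    four, one per subsquare, and the bounds add up by [sqvol_split]. *)
Lemma corner_measure n (x y h a u v e : R) : h = e * 2 ^+ n -> 0 <= e ->
  0 <= u -> 0 <= v -> 0 <= x -> x + h <= 1 -> 0 <= y -> y + h <= 1 ->
  ((sqvol (trunc_cdf u v) x y h)%:E
    <= mu (`[a, (a + sqvol C x y h)%R[ `&` below u v (corner n x y h a)) /\
  mu (`[a, (a + sqvol C x y h)%R[ `&` below u v (corner n x y h a))
    <= (sqvol (trunc_cdf (u + e) (v + e)) x y h)%:E)%E.
Proof.
move=> + e0 u0 v0; elim: n x y h a => [|n IH] x y h a he x0 x1 y0 y1.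
  have h0 : 0 <= h by rewrite he expr0 mulr1.
  have -> : mu (`[a, (a + sqvol C x y h)%R[ `&` below u v (corner 0 x y h a)) =
      (if (x < u) && (y < v) then sqvol C x y h else 0)%:E.
    have V0 := sqvol_ge0 h0 x0 x1 y0 y1.
    case: ifPn => [/andP[xu yv]|nuv].
      rewrite (_ : _ `&` _ = `[a, a + sqvol C x y h[%classic).
        rewrite lebesgue_measure_itv /= lte_fin ltrDl.
        case: ltP => [_|V0']; first by rewrite -EFinB addrAC subrr add0r.
        by congr EFin; apply/eqP; rewrite eq_le V0 V0'.
      by apply/seteqP; split => [t []//|t ?]; split.
    rewrite (_ : _ `&` _ = set0) ?measure0 //.
    by apply/seteqP; split => // t [_ [/= xu yv]]; move: nuv; rewrite xu yv.
  have -> : e = h by rewrite he expr0 mulr1.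
  by split; rewrite lee_fin; [exact: sqvol_trunc_le|exact: le_sqvol_trunc].
pose k := h / 2.
have hk : k = e * 2 ^+ n by rewrite /k he exprS; field.
have k0 : 0 <= k by rewrite hk mulr_ge0 // exprn_ge0.
have hkk : h = k + k by rewrite /k; field.
have [xk0 xk xkk] : [/\ 0 <= x + k, x + k <= 1 & x + k + k <= 1] by split; lra.
have [yk0 yk ykk] : [/\ 0 <= y + k, y + k <= 1 & y + k + k <= 1] by split; lra.
have V1 : 0 <= sqvol C x y k by apply: sqvol_ge0.
have V2 : 0 <= sqvol C (x + k) y k by apply: sqvol_ge0.
have V3 : 0 <= sqvol C x (y + k) k by apply: sqvol_ge0.
have V4 : 0 <= sqvol C (x + k) (y + k) k by apply: sqvol_ge0.
pose a1 := a + sqvol C x y k.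
pose a2 := a1 + sqvol C (x + k) y k.
pose a3 := a2 + sqvol C x (y + k) k.
have a4E : a + sqvol C x y h = a3 + sqvol C (x + k) (y + k) k.
  by rewrite -(sqvol_split C x y h) -/k /a3 /a2 /a1; ring.
have aa1 : a <= a1 by rewrite lerDl.
have a12 : a1 <= a2 by rewrite lerDl.
have a23 : a2 <= a3 by rewrite lerDl.
have a34 : a3 <= a3 + sqvol C (x + k) (y + k) k by rewrite lerDl.
set B := below u v _.
have mB : measurable B by exact: measurable_below.
have -> : mu (`[a, (a + sqvol C x y h)%R[ `&` B) =
  (mu (`[a, (a + sqvol C x y k)%R[ `&` below u v (corner n x y k a)) +
   mu (`[a1, (a1 + sqvol C (x + k) y k)%R[ `&` below u v (corner n (x + k) y k a1)) +
   mu (`[a2, (a2 + sqvol C x (y + k) k)%R[ `&` below u v (corner n x (y + k) k a2)) +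
   mu (`[a3, (a3 + sqvol C (x + k) (y + k) k)%R[ `&` below u v (corner n (x + k) (y + k) k a3)))%E.
  rewrite a4E (@lebesgue_measure_itv_split B a a3) //;
    last by rewrite (le_trans aa1) // (le_trans a12).
  rewrite (@lebesgue_measure_itv_split B a a2) //; last by rewrite (le_trans aa1).
  rewrite (@lebesgue_measure_itv_split B a a1) //.
  congr (_ + _ + _ + _)%E; congr (mu _).
  - apply: eq_below => t _ t1; rewrite cornerS; cbv zeta.
    by rewrite -/k -/a1 t1.
  - apply: eq_below => t t1 t2; rewrite cornerS; cbv zeta.
    by rewrite -/k -/a1 -/a2 (ltNge t a1) t1 t2.
  - apply: eq_below => t t2 t3; rewrite cornerS; cbv zeta.
    by rewrite -/k -/a1 -/a2 -/a3 !(ltNge t) (le_trans a12 t2) t2 -ltNge t3.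
  - apply: eq_below => t t3 _; rewrite cornerS; cbv zeta.
    have t2 := le_trans a23 t3.
    by rewrite -/k -/a1 -/a2 -/a3 !(ltNge t) (le_trans a12 t2) t2 t3.
rewrite -!(sqvol_split (trunc_cdf _ _) x y h) -/k !EFinD.
have [l1 r1] := IH x y k a hk x0 xk y0 yk.
have [l2 r2] := IH (x + k) y k a1 hk xk0 xkk y0 yk.
have [l3 r3] := IH x (y + k) k a2 hk x0 xk yk0 ykk.
have [l4 r4] := IH (x + k) (y + k) k a3 hk xk0 xkk yk0 ykk.
by split; do 3?[apply: leeD => //].
Qed.

(** A copula is monotone and 1-Lipschitz in each variable: [h1] to [h4] are volumes of rectangles
    with one side on the boundary, where [C] is known. *)
Lemma copula_bounds u u' v v' : 0 <= u -> u <= u' -> u' <= 1 ->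
  0 <= v -> v <= v' -> v' <= 1 -> C u v <= C u' v' <= C u v + (u' - u) + (v' - v).
Proof.
move=> u0 uu u1 v0 vv v1.
have I z : 0 <= z -> z <= 1 -> z \in `[0, 1] by move=> z0 z1; rewrite in_itv /= z0.
have h1 : 0 <= C u' v - C u' 0 - C u v + C u 0 by apply: (copula_2incr hC) => //; lra.
have h2 : 0 <= C u' 1 - C u' v - C u 1 + C u v by apply: (copula_2incr hC) => //; lra.
have h3 : 0 <= C u' v' - C u' v - C 0 v' + C 0 v by apply: (copula_2incr hC) => //; lra.
have h4 : 0 <= C 1 v' - C 1 v - C u' v' + C u' v by apply: (copula_2incr hC) => //; lra.
move: h1 h2 h3 h4;
rewrite !(copulax0 hC) ?(copula0x hC) ?(copulax1 hC) ?(copula1x hC) ?I //; lra.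
Qed.

(** * The limit map and the image of Lebesgue measure *)

Let c n t := corner n 0 0 1 0 t.
Let phi t : R * R := (limn (fun n => (c n t).1), limn (fun n => (c n t).2)).

Lemma corner_halving t :
  (forall n, (c n t).1 <= (c n.+1 t).1 <= (c n t).1 + 2 ^- n.+1) /\
  (forall n, (c n t).2 <= (c n.+1 t).2 <= (c n t).2 + 2 ^- n.+1).
Proof.
by split=> n; have [] := corner_step n 0 0 0 t ler01; rewrite mul1r => *; apply/andP; split.
Qed.

Lemma corner_phi n t : [/\ (c n t).1 <= (phi t).1, (phi t).1 <= (c n t).1 + 2 ^- n,
  (c n t).2 <= (phi t).2 & (phi t).2 <= (c n t).2 + 2 ^- n].
Proof.
have [h1 h2] := corner_halving t.
have [_ /(_ n)/andP[]] := limn_halving h1; have [_ /(_ n)/andP[]] := limn_halving h2.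
by split.
Qed.

Lemma phi_ge0 t : 0 <= (phi t).1 /\ 0 <= (phi t).2.
Proof. by have [] := corner_phi 0 t. Qed.

Lemma measurable_phi : measurable_fun setT
  (phi : measurableTypeR R -> measurableTypeR R * measurableTypeR R).
Proof.
apply: measurable_fun_pair.
- apply: (measurable_fun_cvg (h := fun n t => (c n t).1)) => [n|t _].
    exact: (measurableT_comp measurable_fst (measurable_corner n 0 0 1 0)).
  by have [h _] := corner_halving t; have [] := limn_halving h.
- apply: (measurable_fun_cvg (h := fun n t => (c n t).2)) => [n|t _].
    exact: (measurableT_comp measurable_snd (measurable_corner n 0 0 1 0)).
  by have [_ h] := corner_halving t; have [] := limn_halving h.
Qed.

(** This is [corner_measure] on the unit square, of volume 1; the terms of the truncated volume on
    the lower and left edges vanish. *)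
Lemma corner_cdf n u v : 0 <= u -> 0 <= v ->
  ((C (Num.min 1 u) (Num.min 1 v))%:E <= mu (`[0%R, 1%R[ `&` below u v (c n)) /\
  mu (`[0%R, 1%R[ `&` below u v (c n))
    <= (C (Num.min 1 (u + 2 ^- n)%R) (Num.min 1 (v + 2 ^- n)%R))%:E)%E.
Proof.
move=> u0 v0.
have I0 : 0 \in `[0, 1 : R] by rewrite in_itv /= lexx ler01.
have I1 : 1 \in `[0, 1 : R] by rewrite in_itv /= lexx ler01.
have V1 : sqvol C 0 0 1 = 1.
  by rewrite /sqvol !add0r (copulax1 hC) // (copulax0 hC) // !(copula0x hC) //; ring.
have Vt w z : 0 <= w -> 0 <= z ->
    sqvol (trunc_cdf w z) 0 0 1 = C (Num.min 1 w) (Num.min 1 z).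
  move=> w0 z0; rewrite /sqvol /trunc_cdf !add0r !(min_idPl w0) !(min_idPl z0).
  have I (y : R) : 0 <= y -> 0 <= Num.min 1 y <= 1.
    by move=> y0; rewrite le_min ler01 y0 ge_min lexx.
  by rewrite (copulax0 hC) ?(copula0x hC) ?in_itv ?lexx ?ler01 /= ?I //; ring.
have e0 : 0 <= 2 ^- n :> R by rewrite invr_ge0 exprn_ge0.
have := @corner_measure n 0 0 1 0 u v (2 ^- n).
rewrite mulVf ?expf_neq0 // V1 !Vt ?addr_ge0 // !add0r.
by apply.
Qed.

(** The preimage of [[0, u] x [0, v]] under [phi] is squeezed between sets of points whose depth-[n]
    corner is below a nearby point. Their masses are controlled by [corner_cdf], and the error
    vanishes since [C] is Lipschitz. *)
Lemma copula_measure_exists :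
  exists P : probability (measurableTypeR R * measurableTypeR R)%type R, has_cdf P C.
Proof.
have mI : measurable (`[0, 1[ : set (measurableTypeR R)) by [].
(* Normalization only provides the structure of a probability: the total mass is already 1, so the
   Dirac default is not taken. *)
pose P0 : probability (measurableTypeR R) R :=
  mnormalize (mrestr mu mI) (dirac (0 : measurableTypeR R)).
have m1 : mrestr mu mI setT = 1%E.
  by rewrite /mrestr setTI lebesgue_measure_itv /= lte_fin ltr01 oppr0 adde0.
have P0E A : P0 A = mu (A `&` `[0, 1[).
  rewrite /P0 /= /mnormalize; set m := (X in X == 0%E).
  rewrite (_ : m = 1%E) // onee_eq0 /=.
  by rewrite [X in X == +oo%E](_ : _ = 1%E) // [X in fine X](_ : _ = 1%E) //= invr1 mule1.
have mphi : @measurable_fun _ _ (measurableTypeR R)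
    (measurableTypeR R * measurableTypeR R)%type setT phi := measurable_phi.
pose X : {RV P0 >-> (measurableTypeR R * measurableTypeR R)%type} :=
  @mfun_Sub _ _ (measurableTypeR R) (measurableTypeR R * measurableTypeR R)%type phi
    (mem_set mphi).
exists (distribution P0 X) => u v; rewrite !in_itv /= => /andP[u0 u1] /andP[v0 v1].
rewrite /distribution /pushforward P0E.
set E := _ @^-1` _.
have mE : measurable E.
  rewrite -[E]setTI; apply: measurable_phi => //; exact: measurableX.
have EE t : E t <-> (phi t).1 <= u /\ (phi t).2 <= v.
  rewrite /E /= !in_itv /=; have [-> ->] := phi_ge0 t; tauto.
(* Below, each coordinate is shifted by [e], which costs [2 * e]. Above, [corner_cdf] adds a second
   shift by [e], hence [4 * e]. *)
have cmp n : let e := 2 ^- n in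
    ((C u v - 2 * e)%:E <= mu (E `&` `[0%R, 1%R[) <= (C u v + 4 * e)%:E)%E.
  move=> e; have e0 : 0 <= e by rewrite invr_ge0 exprn_ge0.
  have mB w z : measurable (`[0, 1[ `&` below w z (c n)).
    by apply: measurableI => //; exact: measurable_below.
  apply/andP; split.
    (* The maximum keeps the arguments of [corner_cdf] nonnegative; where it is 0, no corner is
       strictly below. *)
    pose w := Num.max 0 (u - e); pose z := Num.max 0 (v - e).
    have w0 : 0 <= w by rewrite le_max lexx.
    have z0 : 0 <= z by rewrite le_max lexx.
    have wu : w <= u by rewrite ge_max u0; lra.
    have zv : z <= v by rewrite ge_max v0; lra.
    have uw : u - e <= w by rewrite le_max lexx orbT.
    have vz : v - e <= z by rewrite le_max lexx orbT.
    have [h _] := corner_cdf n w0 z0; apply: le_trans (le_trans h _).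
      rewrite lee_fin !(min_idPr _); [|lra|lra].
      by have /andP[_] := copula_bounds w0 wu u1 z0 zv v1; lra.
    apply: le_measure; [by rewrite inE; exact: mB|by rewrite inE; exact: measurableI|].
    move=> t [t01 [/= c1 c2]]; split => //; apply/EE.
    have [_ p1 _ p2] := corner_phi n t.
    have [d1 d2] := corner_ge n 0 0 0 t (@ler01 R).
    rewrite -/(c n t) in d1 d2.
    move: c1 c2; rewrite /w /z !lt_max !ltNge d1 d2 /= -!ltNge => c1 c2.
    by split; [apply: le_trans p1 _|apply: le_trans p2 _]; rewrite -/e; lra.
  have e1 : 0 < e by rewrite invr_gt0 exprn_gt0.
  have [_ h] := @corner_cdf n (u + e) (v + e) (addr_ge0 u0 e0) (addr_ge0 v0 e0).
  rewrite -/e in h.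
  apply: le_trans (le_trans _ h) _.
    apply: le_measure; [by rewrite inE; exact: measurableI|by rewrite inE; exact: mB|].
    move=> t [/EE[p1 p2] t01]; split => //.
    have [q1 _ q2 _] := corner_phi n t.
    by split; [apply: le_lt_trans q1 _|apply: le_lt_trans q2 _]; lra.
  set w := Num.min 1 _; set z := Num.min 1 _.
  have uw : u <= w by rewrite le_min u1; lra.
  have vz : v <= z by rewrite le_min v1; lra.
  have w1 : w <= 1 by rewrite ge_min lexx.
  have z1 : z <= 1 by rewrite ge_min lexx.
  have wu : w <= u + e + e by rewrite ge_min lexx orbT.
  have zv : z <= v + e + e by rewrite ge_min lexx orbT.
  by rewrite lee_fin; have /andP[_] := copula_bounds u0 uw w1 v0 vz z1; lra.
have fE : mu (E `&` `[0%R, 1%R[) \is a fin_num.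
  have /andP[h1 h2] := cmp 0.
  rewrite ge0_fin_numE ?measure_ge0 //; exact: le_lt_trans h2 (ltry _).
rewrite -(fineK fE) in cmp *; congr EFin.
apply/eqP; rewrite eq_le; apply/andP; split; apply/ler_addgt0Pr => eps eps0.
- have [n hn] : exists n, 2 ^- n < eps / 4 by apply: exprhalf_lt; rewrite divr_gt0.
  by have /andP[_] := cmp n; rewrite lee_fin; lra.
- have [n hn] : exists n, 2 ^- n < eps / 4 by apply: exprhalf_lt; rewrite divr_gt0.
  have e0 : 0 <= 2 ^- n :> R by rewrite invr_ge0 exprn_ge0.
  by have /andP[+ _] := cmp n; rewrite lee_fin; lra.
Qed.

End copula_existence.

(** * Bounds on the integral of a copula against its own measure *)

Section probability_complements.
Context d (T : measurableType d) (R : realType) (P : probability T R).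

Lemma probabilityD (A B : set T) : measurable A -> measurable B -> A `<=` B ->
  P (B `\` A) = (P B - P A)%E.
Proof.
move=> mA mB AB; rewrite measureD ?setIidr //.
by rewrite (le_lt_trans (probability_le1 _ _)) // ltry.
Qed.

(** The mean of a nonnegative variable is the integral of its tail [ccdf X]. The tail is
    nonincreasing and 0 at 1, so it vanishes beyond 1, and [1 - r] remains to be integrated over
    [[0, 1]]. *)
Lemma expectation_uniform01 (X : {RV P >-> R}) : (forall z, 0 <= X z) ->
  (forall r, 0 <= r <= 1 -> ccdf X r = (1 - r)%:E) -> ('E_P[X] = (1 / 2)%:E)%E.
Proof.
move=> X0 cX; rewrite ge0_expectation_ccdf //.
transitivity (\int[lebesgue_measure]_(r in `[0%R, +oo[)
    ((fun r : R => ((unstable.onem r) ^+ 1)%:E) \_ `[0%R, 1%R]%classic) r)%E.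
  apply: eq_integral => r /set_mem /=; rewrite in_itv /= andbT patchE => r0.
  case: ifPn => [/set_mem|/negP r1].
    by rewrite /= in_itv /= expr1 => /cX.
  apply/eqP; rewrite eq_le measure_ge0 andbT.
  have c1 : ccdf X 1 = 0%E by rewrite cX ?ler01 ?lexx // subrr.
  apply: le_trans (_ : ccdf X 1 <= 0)%E; last by rewrite c1.
  apply: ccdf_nonincreasing; rewrite leNgt; apply/negP => r1'.
  by apply: r1; apply/mem_set; rewrite /= in_itv /= r0 ltW.
rewrite -integral_mkcondr (_ : _ `&` _ = `[0%R, 1%R]%classic).
  have := @Rintegral_onemXn R 1; rewrite /Rintegral div1r => <-.
  rewrite fineK //; apply: integrable_fin_num => //.
  apply: continuous_compact_integrable; first exact: segment_compact.
  apply: continuous_subspaceT => x.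
  by apply: (@continuousB _ R^o); [exact: cvg_cst|exact: cvg_id].
by apply/seteqP; split => r /=; rewrite !in_itv /= ?andbT; [case|move=> /andP[-> ->]].
Qed.

End probability_complements.

(** * Masses of the quadrants and integral of the copula *)

Section kendall.
Context (R : realType) (C : R -> R -> R).
Hypothesis hC : copula C.
Local Notation T := (measurableTypeR R * measurableTypeR R)%type.
Variable P : probability T R.
Hypothesis hP : has_cdf P C.
Let sq : set T := @unit_square R.
Local Notation half := (1 / 2 : R).
Local Notation d := (C half half).

Let rect (u v : R) : set T := `[0, u] `*` `[0, v].

Let measurable_rect u v : measurable (rect u v).
Proof. exact: measurableX. Qed.

Let msq : measurable sq.
Proof. exact: measurable_rect. Qed.

Lemma probability_rect u v : 0 <= u <= 1 -> 0 <= v <= 1 -> P (rect u v) = (C u v)%:E.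
Proof. by move=> hu hv; rewrite hP. Qed.

Lemma probability_square : P sq = 1%E.
Proof.
by rewrite -[sq]/(rect 1 1) probability_rect ?(copulax1 hC) ?in_itv /= ?ler01 ?lexx.
Qed.

Lemma fine_probabilityD (A B : set T) : measurable A -> measurable B -> A `<=` B ->
  fine (P (B `\` A)) = fine (P B) - fine (P A).
Proof.
by move=> mA mB AB; rewrite probabilityD // fineB // fin_num_measure.
Qed.

Lemma bounded_square_integrable (f : T -> R) (M : R) : measurable_fun sq f ->
  (forall z, sq z -> `|f z| <= M) -> P.-integrable sq (EFin \o f).
Proof.
move=> mf fM; apply: measurable_bounded_integrable => //.
  by rewrite (le_lt_trans (probability_le1 _ _)) // ltry.
exists M; split; first by rewrite num_real.
by move=> N MN z sz; exact: le_trans (fM z sz) (ltW MN).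
Qed.

Lemma Rintegral_square_indic (A : set T) : measurable A -> A `<=` sq ->
  \int[P]_(z in sq) \1_A z = fine (P A).
Proof.
by move=> mA As; rewrite /Rintegral integral_indic // setIidl.
Qed.

(** On the square, [C] at [z] is the [P]-mass of the section at [z] of the measurable relation [A],
    and section masses depend measurably on the point. *)
Lemma measurable_copula : measurable_fun sq (fun z : T => C z.1 z.2).
Proof.
pose A : set (T * T) := [set p | ((0 <= p.2.1) && (p.2.1 <= p.1.1)) &&
                                 ((0 <= p.2.2) && (p.2.2 <= p.1.2))].
have mA : measurable A.
  have m21 : measurable_fun setT (fun p : T * T => p.2.1).
    exact: (measurableT_comp measurable_fst measurable_snd).
  have m22 : measurable_fun setT (fun p : T * T => p.2.2).
    exact: (measurableT_comp measurable_snd measurable_snd).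
  have m11 : measurable_fun setT (fun p : T * T => p.1.1).
    exact: (measurableT_comp measurable_fst measurable_fst).
  have m12 : measurable_fun setT (fun p : T * T => p.1.2).
    exact: (measurableT_comp measurable_snd measurable_fst).
  rewrite -[A]setTI; apply: (measurable_and (measurable_and _ _) (measurable_and _ _)) => //;
    exact: measurable_fun_ler.
apply: (eq_measurable_fun (fun z => fine (P (xsection A z)))).
  move=> [u v] /set_mem[/= u01 v01]; rewrite !in_itv /= in u01 v01.
  rewrite (_ : xsection A _ = rect u v) ?probability_rect //.
  apply/seteqP; split => -[s t].
    by move=> /set_mem /= /andP[hs ht]; split; rewrite /= in_itv.
  by case=> /=; rewrite !in_itv /= => hs ht; apply/mem_set; rewrite /A /= hs ht.
apply: measurable_funTS; apply: measurableT_comp => //.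
exact: measurable_fun_xsection.
Qed.

(** Extended by 0 off the square, which has full mass, [p] is a random variable uniform on
    [[0, 1]]. *)
Lemma Rintegral_uniform_margin (p : T -> R) : measurable_fun setT p ->
  (forall z, sq z -> 0 <= p z <= 1) ->
  (forall r, 0 <= r <= 1 -> P (sq `&` [set z | p z <= r]) = r%:E) ->
  \int[P]_(z in sq) p z = half.
Proof.
move=> mp p01 pr.
have mX : @measurable_fun _ _ T R setT (p \_ sq).
  exact: (iffLR (measurable_restrictT _ msq) (measurable_funTS mp)).
pose X : {RV P >-> R} := @mfun_Sub _ _ T R _ (mem_set mX).
have X0 z : 0 <= X z.
  by rewrite /X /= patchE; case: ifPn => // /[!inE] /p01 /andP[].
rewrite /Rintegral; transitivity (fine ('E_P[X])%E).
  rewrite expectation_def integral_mkcond; congr fine; apply: eq_integral => z _.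
  by rewrite /X /= !patchE; case: ifP.
rewrite expectation_uniform01 // => r /[dup] r01 /andP[r0 r1].
rewrite /ccdf /distribution /pushforward.
rewrite (_ : X @^-1` _ = sq `\` (sq `&` [set z | p z <= r])).
  rewrite probabilityD // ?probability_square ?pr //.
  have := measurable_funTS mp msq (measurable_itv `]-oo, r]).
  by congr measurable; apply/seteqP; split => z [? /=]; rewrite in_itv /=.
apply/seteqP; split => z /=; rewrite in_itv /= andbT patchE.
  case: ifPn => [|]; rewrite ?notin_setE ?inE; last by rewrite ltNge r0.
  by move=> sz rz; split => // -[_]; rewrite leNgt rz.
by case=> sz nz; rewrite mem_set // ltNge; apply/negP => zr; exact: nz.
Qed.

(** The letters refer to the first and second coordinates: [L] for at most 1/2, [R] for above
    1/2. *)
Let LR := rect half 1 `\` rect half half.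
Let RL := rect 1 half `\` rect half half.
Let RR := (sq `\` rect half 1) `\` RL.

Let rectS u u' v v' : u <= u' -> v <= v' -> rect u v `<=` rect u' v'.
Proof.
move=> uu vv [s t] [/=]; rewrite !in_itv /= => /andP[s0 su] /andP[t0 tv].
by split; rewrite /= in_itv /= ?s0 ?t0 /=; [exact: le_trans uu|exact: le_trans vv].
Qed.

(** Each quadrant is built from differences of nested sets, so its mass follows by subtraction from
    [C half 1 = half] and [C 1 half = half]. *)
Lemma quadrant_probabilities :
  [/\ fine (P LR) = half - d, fine (P RL) = half - d & fine (P RR) = d].
Proof.
have h01 : 0 <= half <= 1 by lra.
have o01 : 0 <= (1 : R) <= 1 by lra.
have [hh0 hh1] := andP h01.
have hI : half \in `[0, 1] by rewrite in_itv.
have pLR : fine (P LR) = half - d.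
  by rewrite fine_probabilityD ?probability_rect ?(copulax1 hC) //; apply: rectS.
have pRL : fine (P RL) = half - d.
  by rewrite fine_probabilityD ?probability_rect ?(copula1x hC) //; apply: rectS.
split => //.
have mRL : measurable RL by exact: measurableD.
have sRL : RL `<=` sq `\` rect half 1.
  move=> [s t] [/= [/= + +] nh]; rewrite !in_itv /= => s1 th.
  move/andP: (th) => [t0 th'].
  split; first by split => //=; rewrite in_itv /= t0 /=; lra.
  by case=> /= /[!in_itv] /= sh _; apply: nh; split; rewrite /= in_itv.
rewrite fine_probabilityD // ?pRL; last exact: measurableD.
rewrite fine_probabilityD ?probability_square ?probability_rect ?(copulax1 hC) //=;
  last exact: rectS.
by lra.
Qed.

Lemma Rintegral_coordinates :
  \int[P]_(z in sq) z.1 = half /\ \int[P]_(z in sq) z.2 = half.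
Proof.
have h11 : 0 <= (1 : R) <= 1 by rewrite ler01 lexx.
split; apply: Rintegral_uniform_margin => //.
- by move=> z []; rewrite /= !in_itv.
- move=> r r01; rewrite (_ : _ `&` _ = rect r 1) ?probability_rect ?(copulax1 hC) ?in_itv //.
  apply/seteqP; split => -[s t]; rewrite /sq /rect /unit_square /= !in_itv /=.
  + by case=> -[/andP[-> _] ->] ->.
  + by move=> [/andP[s0 sr] ->]; rewrite s0 sr; case/andP: r01 => _ /(le_trans sr) ->.
- by move=> z []; rewrite /= !in_itv.
- move=> r r01; rewrite (_ : _ `&` _ = rect 1 r) ?probability_rect ?(copula1x hC) ?in_itv //.
  apply/seteqP; split => -[s t]; rewrite /sq /rect /unit_square /= !in_itv /=.
  + by case=> -[-> /andP[-> _]] ->.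
  + by move=> [-> /andP[s0 sr]]; rewrite s0 sr; case/andP: r01 => _ /(le_trans sr) ->.
Qed.

Let integrable_copula : P.-integrable sq (EFin \o (fun z : T => C z.1 z.2)).
Proof.
apply: (@bounded_square_integrable _ 1); first exact: measurable_copula.
move=> z [z1 z2]; have := copula_range hC z1 z2.
by rewrite in_itv /= => /andP[c0 c1]; rewrite ger0_norm.
Qed.

Let integrable_indic (A : set T) : measurable A ->
  P.-integrable sq (EFin \o (\1_A : T -> R)).
Proof.
move=> mA; apply: (@bounded_square_integrable _ 1).
  exact: measurable_funTS (measurable_indic mA).
by move=> z _; rewrite indicE; case: (_ \in _); rewrite /= ?normr1 ?normr0.
Qed.

Lemma Rintegral_copula_ge : d ^+ 2 <= \int[P]_(z in sq) C z.1 z.2.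
Proof.
have mRL : measurable RL by exact: measurableD.
have mRR : measurable RR by apply: measurableD => //; exact: measurableD.
have sRR : RR `<=` sq by move=> z [[]].
have [_ _ pRR] := quadrant_probabilities.
(* One factor [d] is read as the mass of [RR], so that the left side becomes the integral of
   [d * \1_RR], a pointwise lower bound of [C]. *)
rewrite expr2 -{2}pRR -Rintegral_square_indic // -RintegralZl //; last exact: integrable_indic.
apply: le_Rintegral => //.
  apply: (@bounded_square_integrable _ `|d|).
    apply: measurable_funM => //; exact: measurable_funTS (measurable_indic mRR).
  move=> z _; rewrite indicE; case: (_ \in _); rewrite /= ?mulr1 ?mulr0 ?normr0 //.
move=> [u v] suv; have [u01 v01] := suv; rewrite indicE.
case: (boolP (_ \in _)) => [/set_mem[[_ nl] nb]|_] /=; last first.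
  by rewrite mulr0; have := copula_range hC u01 v01; rewrite in_itv /= => /andP[].
move: u01 v01 => /=; rewrite !in_itv /= => /andP[u0 u1] /andP[v0 v1].
have uh : half < u.
  by rewrite ltNge; apply/negP => uh; apply: nl; split; rewrite /= in_itv /= ?u0 ?v0.
have vh : half < v.
  rewrite ltNge; apply/negP => vh; apply: nb; split.
    by split; rewrite /= in_itv /= ?u0 ?v0.
  by case=> /=; rewrite !in_itv /= => /andP[_]; rewrite leNgt uh.
rewrite mulr1.
by have /andP[] : C half half <= C u v <= C half half + (u - half) + (v - half)
  by apply: copula_bounds => //; lra.
Qed.

Lemma Rintegral_copula_le :
  \int[P]_(z in sq) C z.1 z.2 <= half - (half - d) ^+ 2.
Proof.
have mRL : measurable RL by exact: measurableD.
have mLR : measurable LR by exact: measurableD.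
have sRL : RL `<=` sq by move=> z [zz _]; apply: rectS zz => //; lra.
have sLR : LR `<=` sq by move=> z [zz _]; apply: rectS zz => //; lra.
have [pLR pRL _] := quadrant_probabilities.
have [i1 i2] := Rintegral_coordinates.
have I1 : P.-integrable sq (EFin \o (fst : T -> R)).
  apply: (@bounded_square_integrable _ 1); first exact: measurable_funTS.
  by move=> z [/=]; rewrite in_itv /= => /andP[z0 z1] _; rewrite ger0_norm.
have I2 : P.-integrable sq (EFin \o (snd : T -> R)).
  apply: (@bounded_square_integrable _ 1); first exact: measurable_funTS.
  by move=> z [_ /=]; rewrite in_itv /= => /andP[z0 z1]; rewrite ger0_norm.
have IL := integrable_indic mLR; have IR := integrable_indic mRL.
have ID (f g : T -> R) : P.-integrable sq (EFin \o f) -> P.-integrable sq (EFin \o g) ->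
    P.-integrable sq (EFin \o (fun z => f z + g z)).
  by move=> fi gi; exact: (integrableD msq fi gi).
have IZ (k : R) (f : T -> R) : P.-integrable sq (EFin \o f) ->
    P.-integrable sq (EFin \o (fun z => k * f z)).
  by move=> fi; exact: (integrableZl msq k fi).
have IC := integrable_copula.
(* With [I] the integral of [C], this inequality integrates to
   [2 * I + 2 * (half - d) ^+ 2 <= 1]. *)
suff : \int[P]_(z in sq) (2 * C z.1 z.2 +
         ((half - d) * \1_LR z + (half - d) * \1_RL z))
       <= \int[P]_(z in sq) (z.1 + z.2).
  rewrite !RintegralD ?RintegralZl //; try by [apply: ID; exact: IZ | exact: IZ].
  rewrite i1 i2 !Rintegral_square_indic // pLR pRL expr2.
  by set I := \int[P]_(z in sq) _; lra.
apply: le_Rintegral => //.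
- apply: (ID (fun z => 2 * C z.1 z.2)
      (fun z => (half - d) * \1_LR z + (half - d) * \1_RL z)).
    exact: IZ.
  by apply: (ID (fun z => (half - d) * \1_LR z) (fun z => (half - d) * \1_RL z)); exact: IZ.
- exact: (ID fst snd I1 I2).
move=> [u v] /= [u01 v01]; rewrite /= in u01 v01.
have h01 : half \in `[0, 1] by rewrite in_itv /=; lra.
have [] := (copulax1 hC u01, copula1x hC v01) => Cu1 C1v.
move: u01 v01; rewrite !in_itv /= => /andP[u0 u1] /andP[v0 v1].
have Cu : C u v <= u.
  have /andP[] : C u v <= C u 1 <= C u v + (u - u) + (1 - v) by apply: copula_bounds.
  by rewrite Cu1.
have Cv : C u v <= v.
  have /andP[] : C u v <= C 1 v <= C u v + (1 - u) + (v - v) by apply: copula_bounds.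
  by rewrite C1v.
rewrite !indicE.
have [/set_mem[/= [/= us vs] nh]|_] := boolP ((u, v) \in LR); last first.
  have [/set_mem[/= [/= us vs] nh]|_] := boolP ((u, v) \in RL); last by rewrite /=; lra.
  move: vs; rewrite in_itv /= => /andP[_ vh].
  have uh : half < u.
    by rewrite ltNge; apply/negP => uh; apply: nh; split; rewrite /= in_itv /= ?u0 ?v0.
  (* The volume of [[1/2, u] x [v, 1]] gives [C u v <= u - half + C half v], which is at most
     [u - half + d]; this is added to [C u v <= v]. *)
  have c1 : 0 <= C u 1 - C u v - C half 1 + C half v by apply: (copula_2incr hC) => //; lra.
  have /andP[c2 _] : C half v <= C half half <= C half v + (half - half) + (half - v).
    by apply: copula_bounds => //; lra.
  by move: c1; rewrite Cu1 (copulax1 hC) //=; lra.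
move: us; rewrite in_itv /= => /andP[_ uh].
have vh : half < v.
  by rewrite ltNge; apply/negP => vh; apply: nh; split; rewrite /= in_itv /= ?u0 ?v0.
have -> : ((u, v) \in RL) = false.
  apply/negP => /set_mem[/= [_ /=]]; rewrite in_itv /= v0 /= => hv _.
  by move: vh; rewrite ltNge hv.
(* Symmetrically, the volume of [[u, 1] x [1/2, v]] yields [C u v <= v - half + d], added to
   [C u v <= u]. *)
have c1 : 0 <= C 1 v - C 1 half - C u v + C u half by apply: (copula_2incr hC) => //; lra.
have /andP[c2 _] : C u half <= C half half <= C u half + (half - u) + (half - half).
  by apply: copula_bounds => //; lra.
by move: c1; rewrite C1v (copula1x hC) //=; lra.
Qed.

End kendall.

(** * From the bounds on the integral to the bounds on beta *)

Theorem corollary6 (R : realType) (C : R -> R -> R) (hC : copula C) :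
  beta_lower (kendall_tau C) <= blomqvist_beta C /\
  blomqvist_beta C <= beta_upper (kendall_tau C).
Proof.
have hP : has_cdf (copula_measure C) C.
  (* Existence rules out the Dirac default. *)
  rewrite /copula_measure; case: pselect => [e|[]]; first exact: projT2 (cid e).
  exact: copula_measure_exists.
have ge := Rintegral_copula_ge hC hP.
rewrite /beta_lower /beta_upper /kendall_tau /concordance /blomqvist_beta.
have h01 : 1 / 2 \in `[0, 1 : R] by rewrite in_itv /=; lra.
have d0 : 0 <= C (1 / 2) (1 / 2).
  by have := copula_range hC h01 h01; rewrite in_itv /= => /andP[].
have d1 : C (1 / 2) (1 / 2) <= 1 / 2.
  have /andP[] : C (1 / 2) (1 / 2) <= C (1 / 2) 1 <=
      C (1 / 2) (1 / 2) + (1 / 2 - 1 / 2) + (1 - 1 / 2).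
    by apply: (copula_bounds hC) => //; lra.
  by rewrite (copulax1 hC).
set d := C (1 / 2) (1 / 2) in ge d0 d1 *.
set I := (X in d ^+ 2 <= X) in ge *.
have le : I <= 1 / 2 - (1 / 2 - d) ^+ 2 := Rintegral_copula_le hC hP.
split.
- case: ifP => _; first by lra.
  (* With tau equal to [4 * I - 1], [le] reads [(1 - 2 * d) ^+ 2 <= 1 - tau], and beta is
     [1 - 2 * (1 - 2 * d)]. *)
  have : 1 - 2 * d <= Num.sqrt (1 - (4 * I - 1)).
    rewrite -[leLHS]ger0_norm; last by lra.
    by rewrite -sqrtr_sqr ler_wsqrtr //; move: le; rewrite !expr2; lra.
  by lra.
- case: ifP => _; first by lra.
  (* Likewise [ge] reads [(2 * d) ^+ 2 <= 1 + tau], and beta is [-1 + 2 * (2 * d)]. *)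
  have : 2 * d <= Num.sqrt (1 + (4 * I - 1)).
    rewrite -[leLHS]ger0_norm; last by lra.
    by rewrite -sqrtr_sqr ler_wsqrtr //; move: ge; rewrite !expr2; lra.
  by lra.
Qed.
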